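(* Let $\mathbf{R}$ be the variety of finite $\mathcal{R}$-trivial monoids and let $\mathbf{L}$ be the variety of finite $\mathcal{L}$-trivial monoids. Then the join of these two varieties satisfies $$\mathbf{R} \vee \mathbf{L} = [\![\, (xy)^\omega x (zx)^\omega = (xy)^\omega (zx)^\omega \,]\!].$$ That is, a finite monoid $M$ belongs to $\mathbf{R} \vee \mathbf{L}$ if and only if $(xy)^\omega x (zx)^\omega = (xy)^\omega (zx)^\omega$ for all $x, y, z \in M$.
   Context: For a finite monoid $M$ and $u,v \in M$, Green's relations are: $u \mathrel{\mathcal{R}} v$ iff $uM = vM$, and $u \mathrel{\mathcal{L}} v$ iff $Mu = Mv$. The monoid $M$ is $\mathcal{R}$-trivial (respectively $\mathcal{L}$-trivial) if $\mathcal{R}$ (respectively $\mathcal{L}$) is the identity relation on $M$. A variety of finite monoids (also called a pseudovariety) is a class of finite monoids closed under finite direct products, submonoids, and quotients. The join $\mathbf{V}_1 \vee \mathbf{V}_2$ of two varieties is the smallest variety containing $\mathbf{V}_1 \cup \mathbf{V}_2$; a monoid $M$ is in $\mathbf{V}_1 \vee \mathbf{V}_2$ if and only if there exist $M_1 \in \mathbf{V}_1$ and $M_2 \in \mathbf{V}_2$ such that $M$ is a quotient of a submonoid of $M_1 \times M_2$. For an element $u$ of a finite monoid $M$, $u^\omega$ denotes the unique idempotent generated by $u$; equivalently $u^\omega = u^{\omega_M}$ for an integer $\omega_M \geqslant 1$ such that $w^{\omega_M}$ is idempotent for all $w \in M$. For two $\omega$-terms $s,t$ (expressions built from variables by concatenation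 and the operation $(\cdot)^\omega$), $[\![ s = t ]\!]$ denotes the class of finite monoids in which $s = t$ holds for every assignment of elements of the monoid to the variables. One has $\mathbf{R} = [\![ (xy)^\omega x = (xy)^\omega ]\!]$ and $\mathbf{L} = [\![ x(zx)^\omega = (zx)^\omega ]\!]$. *)

(* Defs.v *)
From HB Require Import structures.
From mathcomp Require Import all_boot.

Set Implicit Arguments.
Unset Strict Implicit.
Unset Printing Implicit Defensive.

Local Open Scope group_scope.

#[short(type="finMonoidType")]
HB.structure Definition FinMonoid := {M of Monoid M & Finite M}.

HB.instance Definition _ (M N : finMonoidType) := Monoid.on (M * N)%type.

Section Green.
Variable M : finMonoidType.

Definition rideal (u : M) : {set M} := [set u * m | m : M].
Definition lideal (u : M) : {set M} := [set m * u | m : M].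

Definition greenR (u v : M) : Prop := rideal u = rideal v.
Definition greenL (u v : M) : Prop := lideal u = lideal v.

End Green.

Definition monoid_class := finMonoidType -> Prop.

Definition Rtrivial : monoid_class := fun M => forall u v : M, greenR u v <-> u = v.
Definition Ltrivial : monoid_class := fun M => forall u v : M, greenL u v <-> u = v.

(* Submonoids and quotients are taken up to isomorphism, as injective and
   surjective morphisms; the one-element monoids are the empty products. *)
Record variety (V : monoid_class) : Prop := Variety {
  variety_unit : forall M : finMonoidType, #|M| = 1%N -> V M;
  variety_prod : forall M N : finMonoidType, V M -> V N -> V (M * N)%type;
  variety_sub : forall (M N : finMonoidType) (f : UMagmaMorphism.type N M),
    injective f -> V M -> V N;
  variety_quo : forall (M N : finMonoidType) (f : UMagmaMorphism.type M N),
    (forall y : N, exists x : M, f x = y) -> V M -> V N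
}.

Definition subclass (V W : monoid_class) : Prop := forall M, V M -> W M.

(* The smallest variety containing V1 and V2, as the intersection of all the
   varieties that contain both. *)
Definition join (V1 V2 : monoid_class) : monoid_class := fun M =>
  forall W : monoid_class, variety W -> subclass V1 W -> subclass V2 W -> W M.

Section OmegaPower.
Variable M : finMonoidType.

Definition idem (e : M) : bool := e * e == e.

Lemma omega_exp_subproof :
  exists n : nat, (0 < n)%N && [forall w : M, idem (w ^+ n)].
Proof.
exists #|M|`!; rewrite fact_gt0; apply/forallP => w; apply/eqP.
have [i [p [p_gt0 le_ip wip]]] : exists i p : nat,
    [/\ (0 < p)%N, (i + p <= #|M|)%N & w ^+ (i + p) = w ^+ i].
  pose f (k : 'I_#|M|.+1) := w ^+ k.
  have /injectivePn [a [b]] : ~~ injectiveb f.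
    apply/negP => /injectiveP /leq_card; rewrite card_ord.
    by rewrite ltnn.
  wlog lt_ab : a b / (a < b)%N => [wl neq_ab fab|_ fab].
    case: (ltngtP a b) => [lt|lt|/val_inj eq_ab]; first exact: (wl a b).
      by apply: (wl b a) => //; rewrite eq_sym.
    by rewrite eq_ab eqxx in neq_ab.
  exists a, (b - a)%N; rewrite subn_gt0 lt_ab subnKC ?(ltnW lt_ab) //.
  by split=> //; rewrite -ltnS ltn_ord.
have per k : w ^+ (i + k * p) = w ^+ i.
  elim: k => [|k IHk]; first by rewrite mul0n addn0.
  by rewrite mulSn addnA expgnDr wip -expgnDr IHk.
have le_pM : (p <= #|M|)%N by apply: leq_trans le_ip; rewrite leq_addl.
have le_iM : (i <= #|M|`!)%N.
  apply: (@leq_trans #|M|); first exact: leq_trans (leq_addr _ _) le_ip.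
  by case: #|M| => // m; rewrite factS leq_pmulr ?fact_gt0.
have /dvdnP[k Dk] : (p %| #|M|`!)%N by rewrite dvdn_fact ?p_gt0.
rewrite -expgnDr -{1 3}(subnK le_iM) {2}Dk -addnA expgnDr per.
by rewrite -expgnDr.
Qed.

(* The integer omega_M: a positive exponent turning every element of M into
   an idempotent. *)
Definition omega_exp : nat := ex_minn omega_exp_subproof.

Definition omega (u : M) : M := u ^+ omega_exp.

Lemma omega_exp_gt0 : (0 < omega_exp)%N.
Proof. by rewrite /omega_exp; case: ex_minnP => n /andP[]. Qed.

Lemma omega_idem (u : M) : idem (omega u).
Proof.
by rewrite /omega /omega_exp; case: ex_minnP => n /andP[_ /forallP].
Qed.

Lemma omega_uniq (u : M) (n : nat) :
  (0 < n)%N -> idem (u ^+ n) -> omega u = u ^+ n.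
Proof.
have idemX (e : M) k : (0 < k)%N -> idem e -> e ^+ k = e.
  by case: k => // k _ /eqP ee; elim: k => // k IHk; rewrite expgS IHk.
move=> n_gt0 idn; rewrite -[LHS](idemX _ n) ?omega_idem //.
by rewrite -[RHS](idemX _ omega_exp) ?omega_exp_gt0 // -!expgnA mulnC.
Qed.

End OmegaPower.

Lemma greenRP (M : finMonoidType) (u v : M) :
  greenR u v <-> (exists a, u * a = v) /\ (exists b, v * b = u).
Proof.
split=> [eq_uv|[[a Da] [b Db]]].
  split; [have : v \in rideal u | have : u \in rideal v].
  - by rewrite eq_uv; apply/imsetP; exists 1; rewrite ?mulg1.
  - by case/imsetP=> a _ ->; exists a.
  - by rewrite -eq_uv; apply/imsetP; exists 1; rewrite ?mulg1.
  - by case/imsetP=> b _ ->; exists b.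
apply/setP=> w; apply/imsetP/imsetP=> -[m _ ->].
  by exists (b * m); rewrite // mulgA Db.
by exists (a * m); rewrite // mulgA Da.
Qed.

Lemma greenLP (M : finMonoidType) (u v : M) :
  greenL u v <-> (exists a, a * u = v) /\ (exists b, b * v = u).
Proof.
split=> [eq_uv|[[a Da] [b Db]]].
  split; [have : v \in lideal u | have : u \in lideal v].
  - by rewrite eq_uv; apply/imsetP; exists 1; rewrite ?mul1g.
  - by case/imsetP=> a _ ->; exists a.
  - by rewrite -eq_uv; apply/imsetP; exists 1; rewrite ?mul1g.
  - by case/imsetP=> b _ ->; exists b.
apply/setP=> w; apply/imsetP/imsetP=> -[m _ ->].
  by exists (m * b); rewrite // -mulgA Db.
by exists (m * a); rewrite // -mulgA Da.
Qed.

Lemma omegaM (M : finMonoidType) (u : M) : omega u * omega u = omega u.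
Proof. exact/eqP/omega_idem. Qed.

Lemma variety_Rtrivial : variety Rtrivial.
Proof.
split=> [M M1 u v | M N RM RN [u1 u2] [v1 v2] | M N f injf RM u v
  | M N f surjf RM u v].
- split=> [_|->] //; have /card_le1_eqP : (#|M| <= 1)%N by rewrite M1.
  by apply.
- split=> [/greenRP[[[a1 a2] [/= Da1 Da2]] [[b1 b2] [/= Db1 Db2]]]|->] //.
  congr pair; [apply/RM | apply/RN]; apply/greenRP.
    by split; [exists a1 | exists b1].
  by split; [exists a2 | exists b2].
- split=> [/greenRP[[a Da] [b Db]]|->] //; apply/injf/RM/greenRP.
  by split; [exists (f a) | exists (f b)]; rewrite -gmulfM ?Da ?Db.
split=> [/greenRP[[a Da] [b Db]]|->] //.
have [[u' Du] [a' Da'] [b' Db']] := And3 (surjf u) (surjf a) (surjf b).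
pose e := omega (a' * b'); pose n := (omega_exp M).-1.
have De : e = a' * b' * (a' * b') ^+ n.
  by rewrite -expgS prednK ?omega_exp_gt0.
have fe : f (u' * e) = u.
  rewrite gmulfM Du /e /omega gmulfXn gmulfM Da' Db'.
  elim: (omega_exp M) => [|k IHk]; first by rewrite mulg1.
  by rewrite expgS !mulgA Da Db.
have /RM eq_ue : greenR (u' * e) (u' * e * a').
  apply/greenRP; split; first by exists a'.
  exists (b' * (a' * b') ^+ n).
  by rewrite -!mulgA (mulgA a' b') -De omegaM.
by rewrite -Da -Da' -{2}fe -gmulfM -eq_ue fe.
Qed.

Lemma variety_Ltrivial : variety Ltrivial.
Proof.
split=> [M M1 u v | M N LM LN [u1 u2] [v1 v2] | M N f injf LM u v
  | M N f surjf LM u v].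
- split=> [_|->] //; have /card_le1_eqP : (#|M| <= 1)%N by rewrite M1.
  by apply.
- split=> [/greenLP[[[a1 a2] [/= Da1 Da2]] [[b1 b2] [/= Db1 Db2]]]|->] //.
  congr pair; [apply/LM | apply/LN]; apply/greenLP.
    by split; [exists a1 | exists b1].
  by split; [exists a2 | exists b2].
- split=> [/greenLP[[a Da] [b Db]]|->] //; apply/injf/LM/greenLP.
  by split; [exists (f a) | exists (f b)]; rewrite -gmulfM ?Da ?Db.
split=> [/greenLP[[a Da] [b Db]]|->] //.
have [[u' Du] [a' Da'] [b' Db']] := And3 (surjf u) (surjf a) (surjf b).
pose e := omega (b' * a'); pose n := (omega_exp M).-1.
have De : e = (b' * a') ^+ n * (b' * a').
  by rewrite -expgSr prednK ?omega_exp_gt0.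
have fe : f (e * u') = u.
  rewrite gmulfM Du /e /omega gmulfXn gmulfM Da' Db'.
  elim: (omega_exp M) => [|k IHk]; first by rewrite mul1g.
  by rewrite expgSr -!mulgA Da Db.
have /LM eq_ue : greenL (e * u') (a' * (e * u')).
  apply/greenLP; split; first by exists a'.
  exists ((b' * a') ^+ n * b').
  by rewrite !mulgA -(mulgA _ b' a') -De omegaM.
by rewrite -Da -Da' -{2}fe -gmulfM -eq_ue fe.
Qed.

Inductive omega_term : Type :=
  | OVar of nat
  | OMul of omega_term & omega_term
  | OPow of omega_term.

Declare Scope omega_scope.
Delimit Scope omega_scope with W.
Bind Scope omega_scope with omega_term.
Notation "s * t" := (OMul s t) : omega_scope.
Notation "s ^ω" := (OPow s) (at level 2, left associativity, format "s ^ω")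
  : omega_scope.

Fixpoint omega_eval (M : finMonoidType) (a : nat -> M) (t : omega_term) : M :=
  match t with
  | OVar i => a i
  | OMul t1 t2 => omega_eval a t1 * omega_eval a t2
  | OPow t1 => omega (omega_eval a t1)
  end.

Definition identity_class (s t : omega_term) : monoid_class := fun M =>
  forall a : nat -> M, omega_eval a s = omega_eval a t.

Notation "⟦ s = t ⟧" := (identity_class s t) (s at level 69, t at level 69).

(* Main.v *)
(* Suppose that M satisfies the identity. A letter x with p x R p and x s L s can
   be deleted: p x s = p s. Moreover the set of letters that keep p inside its
   R-class depends only on this R-class. Hence the letters where a word u leaves
   an R-class, read from the left, are each the first letter outside a given
   alphabet, and an R-trivial monoid can locate the corresponding letters in
   another word v; dually an L-trivial monoid locates in u the letters where v,
   read from the right, leaves an L-class. The latter are determined by rightmost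
   embeddings of subwords, so the R-trivial monoid also sees the relative order of
   the two kinds of marked letters. If u and v have the same image in both
   monoids, then the marked letters cut u and v into matching blocks, and these
   can be exchanged one after the other, starting from the left, because all
   letters in the two blocks are deletable between the prefix of u and the suffix
   of v. Thus u = v in M, that is, M divides the product of the two monoids. *)

From HB Require Import structures.
Require Import Defs.
From mathcomp Require Import all_boot zify.

Set Implicit Arguments.
Unset Strict Implicit.
Unset Printing Implicit Defensive.

Local Open Scope group_scope.

Definition rl_identity (M : finMonoidType) : Prop :=
  forall x y z : M,
    omega (x * y) * x * omega (z * x) = omega (x * y) * omega (z * x).

(** * The opposite monoid *)

(** A separate name for the carrier, to which the reversed product is attached; dual statements are
    then instances. *)
Definition opp_monoid (M : Type) : Type := M.

Section Opposite.
Variable M : finMonoidType.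

HB.instance Definition _ := Finite.copy (opp_monoid M) M.

Definition opp_mul (x y : opp_monoid M) : opp_monoid M := (y : M) * x.

Lemma opp_mulA : associative opp_mul.
Proof. by move=> x y z; rewrite /opp_mul mulgA. Qed.

Lemma opp_mul1 : left_id (1 : M) opp_mul.
Proof. by move=> x; rewrite /opp_mul mulg1. Qed.

Lemma opp_1mul : right_id (1 : M) opp_mul.
Proof. by move=> x; rewrite /opp_mul mul1g. Qed.

HB.instance Definition _ :=
  isMonoid.Build (opp_monoid M) opp_mulA opp_mul1 opp_1mul.

Lemma opp_mulE (x y : opp_monoid M) : x * y = @mul M y x.
Proof. by []. Qed.

Lemma opp_expE (x : M) n : @natexp (opp_monoid M) x n = @natexp M x n.
Proof. by elim: n => // n IHn; rewrite expgS opp_mulE IHn expgSr. Qed.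

Lemma opp_omega (x : M) : @omega (opp_monoid M) x = @omega M x.
Proof.
rewrite -[RHS]opp_expE; apply: omega_uniq; first exact: omega_exp_gt0.
by rewrite /idem opp_mulE opp_expE; apply: omega_idem.
Qed.

Lemma opp_prod (I : Type) (F : I -> M) (r : seq I) :
  \big[@mul (opp_monoid M)/1]_(i <- r) F i = \prod_(i <- rev r) F i.
Proof.
elim: r => [|i r IHr]; first by rewrite !big_nil.
by rewrite rev_cons -cats1 big_cat big_seq1 big_cons opp_mulE IHr.
Qed.

Lemma Rtrivial_opp : Rtrivial M -> Ltrivial (opp_monoid M).
Proof. by move=> RM u v; apply: RM. Qed.

Lemma Ltrivial_opp : Ltrivial M -> Rtrivial (opp_monoid M).
Proof. by move=> LM u v; apply: LM. Qed.

Lemma rl_identity_opp : rl_identity (opp_monoid M) <-> rl_identity M.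
Proof.
split=> RLM x y z; last first.
  rewrite !opp_mulE !opp_omega mulgA; exact: (RLM x z y).
by have := RLM x z y; rewrite !opp_mulE !opp_omega mulgA.
Qed.

End Opposite.

(** * Stabilising letters *)

Definition rstab (M : finMonoidType) (p : M) : {set M} :=
  [set a | [exists c, p * a * c == p]].

Definition lstab (M : finMonoidType) (s : M) : {set M} :=
  [set a | [exists c, c * (a * s) == s]].

Lemma rstabP (M : finMonoidType) (p a : M) :
  reflect (exists c, p * a * c = p) (a \in rstab p).
Proof.
by rewrite inE; apply: (iffP existsP) => -[c /eqP Dc]; exists c; apply/eqP/eqP.
Qed.

Lemma lstabP (M : finMonoidType) (s a : M) :
  reflect (exists c, c * (a * s) = s) (a \in lstab s).
Proof.
by rewrite inE; apply: (iffP existsP) => -[c /eqP Dc]; exists c; apply/eqP/eqP.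
Qed.

Lemma card_rideal_lt (M : finMonoidType) (p a : M) :
  a \notin rstab p -> (#|rideal (p * a)%g| < #|rideal p|)%N.
Proof.
move=> pa; apply: proper_card; apply/properP; split.
  by apply/subsetP => _ /imsetP[m _ ->]; rewrite -mulgA imset_f.
exists p; first by apply/imsetP; exists 1; rewrite ?mulg1.
by apply: contra pa => /imsetP[c _ Dp]; apply/rstabP; exists c.
Qed.

Lemma card_lideal_lt (M : finMonoidType) (s a : M) :
  a \notin lstab s -> (#|lideal (a * s)%g| < #|lideal s|)%N.
Proof. exact: (@card_rideal_lt (opp_monoid M)). Qed.

Lemma fix_expg (M : finMonoidType) (p w : M) n : p * w = p -> p * w ^+ n = p.
Proof. by move=> pw; elim: n => [|n IHn]; rewrite ?mulg1 // expgS mulgA pw. Qed.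

Lemma fix_omega (M : finMonoidType) (p w : M) : p * w = p -> p * omega w = p.
Proof. exact: fix_expg. Qed.

Lemma expg_rot (M : finMonoidType) (x y : M) n :
  x * (y * x) ^+ n = (x * y) ^+ n * x.
Proof.
elim: n => [|n IHn]; first by rewrite mulg1 mul1g.
by rewrite !expgS mulgA -(mulgA x y) -!mulgA IHn !mulgA.
Qed.

Lemma omega_rot (M : finMonoidType) (x y : M) :
  x * omega (y * x) = omega (x * y) * x.
Proof. exact: expg_rot. Qed.

Section StableLetters.
Variable M : finMonoidType.
Hypothesis RLM : rl_identity M.

Lemma rl_aperiodic (w : M) : omega w * w = omega w.
Proof.
have := RLM w 1 1; rewrite mulg1 mul1g omegaM => {2}<-.
by rewrite -[in RHS]mulgA -[w * _]expgS expgSr mulgA omegaM.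
Qed.

(** The identity with [z] equal to [y] gives ω(xy) x = ω(xy) ω(yx), so ω(xy) y ω(xy) = ω(xy) ω(yx) y
    = ω(xy) x y, which aperiodicity reduces to ω(xy). *)
Lemma rl_absorb (x y : M) : omega (x * y) * y * omega (x * y) = omega (x * y).
Proof.
have Ex : omega (x * y) * x = omega (x * y) * omega (y * x).
  by rewrite -RLM -mulgA omega_rot mulgA omegaM.
by rewrite -mulgA omega_rot mulgA -Ex -mulgA rl_aperiodic.
Qed.

Lemma rstab_sub (p t r : M) : p * t * r = p -> rstab p \subset rstab (p * t).
Proof.
move=> ptr; apply/subsetP => a /rstabP[s pas]; apply/rstabP.
(* This loop at [p * t] goes back to [p], reads [a] and returns. Absorption with [x := r] removes
   the way back, so that [a] is read at [p * t] itself. *)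
pose E := omega (r * (a * (s * t))).
have qE : p * t * E = p * t by apply: fix_omega; rewrite !mulgA ptr pas.
exists (s * t * E).
transitivity (p * t * (E * (a * (s * t)) * E)); first by rewrite !mulgA qE.
by rewrite rl_absorb.
Qed.

Lemma rstab_mul (p a : M) : a \in rstab p -> rstab (p * a) = rstab p.
Proof.
move=> /rstabP[c pac]; apply/eqP; rewrite eqEsubset (rstab_sub pac) andbT.
by rewrite -{2}pac; apply: (@rstab_sub (p * a) c a); rewrite pac.
Qed.

(** [x * y] fixes [p] and [z * x] fixes [s], so ω(xy) and ω(zx) may be inserted around [x], where
    the identity deletes it. *)
Lemma rl_delete (p x s : M) :
  x \in rstab p -> x \in lstab s -> p * x * s = p * s.
Proof.
move=> /rstabP[y pxy] /lstabP[z zxs].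
have pE : p * omega (x * y) = p by apply: fix_omega; rewrite mulgA.
have Es : omega (z * x) * s = s.
  rewrite -opp_omega; apply: (@fix_omega (opp_monoid M) s (z * x)).
  by rewrite opp_mulE -mulgA.
transitivity (p * (omega (x * y) * x * omega (z * x)) * s).
  by rewrite !mulgA pE -!mulgA Es.
by rewrite RLM !mulgA pE -mulgA Es.
Qed.
End StableLetters.

(** * Marked factorisations *)

Local Notation ev w := (\prod_(x <- w) x).

Lemma subseq_skip (T : eqType) (b : T) (s w u : seq T) :
  b \notin w -> subseq (b :: s) (w ++ u) = subseq (b :: s) u.
Proof.
elim: w => //= a w IHw; rewrite inE negb_or => /andP[/negPf ->].
exact: IHw.
Qed.

Lemma subseq_catl (T : eqType) (s w u : seq T) :
  subseq s u -> subseq s (w ++ u).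
Proof. by move=> /subseq_trans; apply; apply: suffix_subseq. Qed.

Variant cat_split (T : Type) (w : seq T) (a : T) (u t : seq T) (b : T)
  (u' : seq T) : Prop :=
| CatSplitLt t1 of t = w ++ a :: t1 & u = t1 ++ b :: u'
| CatSplitEq of t = w & b = a & u' = u
| CatSplitGt w1 of w = t ++ b :: w1 & u' = w1 ++ a :: u.

Lemma cat_splitP (T : Type) (w : seq T) (a : T) (u t : seq T) (b : T)
  (u' : seq T) : w ++ a :: u = t ++ b :: u' -> cat_split w a u t b u'.
Proof.
elim: w t => [|x w IHw] [|y t] /=.
- by case=> -> ->; apply: CatSplitEq.
- by case=> -> ->; apply: (CatSplitLt (t1 := t)).
- by case=> -> <-; apply: (CatSplitGt (w1 := w)).
case=> -> /IHw[t1 -> ->|-> -> ->|w1 -> ->].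
- exact: (CatSplitLt (t1 := t1)).
- exact: CatSplitEq.
exact: (CatSplitGt (w1 := w1)).
Qed.

Lemma size_cat_lt (T : Type) (w : seq T) (a : T) (u w' : seq T) (b : T)
    (v : seq T) n :
  (size (w ++ a :: u) + size (w' ++ b :: v) < n.+1)%N ->
  (size u + size v < n)%N.
Proof. rewrite !size_cat /=; lia. Qed.

Section Marks.
Variable M : finMonoidType.
Hypothesis RLM : rl_identity M.
Implicit Types (p s : M) (u v w : seq M).

Lemma lstab_mul (s a : M) : a \in lstab s -> lstab (a * s) = lstab s.
Proof. exact: (rstab_mul (iffRL (rl_identity_opp M) RLM)). Qed.

Lemma rstab_prod p w :
  all (mem (rstab p)) w -> rstab (p * ev w) = rstab p.
Proof.
elim: w p => [|a w IHw] p /=; first by rewrite big_nil mulg1.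
by move=> /andP[/(rstab_mul RLM) <- /IHw]; rewrite big_cons mulgA.
Qed.

Lemma lstab_prod s w :
  all (mem (lstab s)) w -> lstab (ev w * s) = lstab s.
Proof.
elim: w => [|a w IHw] /=; first by rewrite big_nil mul1g.
by move=> /andP[as_ /IHw ws]; rewrite big_cons -mulgA lstab_mul ws.
Qed.

Lemma delete_word p w s :
  all (mem (rstab p)) w -> all (mem (lstab s)) w -> p * ev w * s = p * s.
Proof.
elim: w => [|a w IHw] /=; first by rewrite big_nil mulg1.
move=> /andP[pa pw] /andP[sa sw].
rewrite -(IHw pw sw) big_cons mulgA -!(mulgA _ (ev w)).
by rewrite rl_delete // lstab_prod.
Qed.

(* The R-descents of p * u, read from left to right, are located at the same
   letters in v, and they have the same position relative to the rightmost
   embeddings of the suffixes of beta. *)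
Inductive rmark (beta : seq M) : M -> seq M -> seq M -> Prop :=
| RmarkNil p u v of
    all (mem (rstab p)) u & all (mem (rstab p)) v : rmark beta p u v
| RmarkCons p w a u w' v of
    all (mem (rstab p)) w & all (mem (rstab p)) w' & a \notin rstab p &
    (forall n, subseq (drop n beta) u = subseq (drop n beta) v) &
    rmark beta (p * ev w * a) u v : rmark beta p (w ++ a :: u) (w' ++ a :: v).

(* The letters of beta are those at the L-descents of v, read from right to
   left, and they are located in the same way in u. *)
Inductive lmark : seq M -> seq M -> seq M -> Prop :=
| LmarkNil u v of
    all (mem (lstab (1 : M))) u & all (mem (lstab (1 : M))) v : lmark [::] u v
| LmarkCons beta b w u w' v of
    all (mem (lstab (b * ev v))) w & all (mem (lstab (b * ev v))) w' &
    b \notin lstab (ev v) & lmark beta u v :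
    lmark (b :: beta) (w ++ b :: u) (w' ++ b :: v).

Lemma lmark_subseq beta u v :
  lmark beta u v -> subseq beta u /\ subseq beta v.
Proof.
elim=> [*|{}beta b w {}u w' {}v _ _ _ _ [bu bv]].
  by rewrite !sub0seq.
by split; apply: subseq_catl; rewrite /= eqxx.
Qed.

(** No mark occurs in the block to its right, so the marks form the rightmost embedding of [beta]; a
    further descent [b] is absent from the first block, hence cannot precede [beta]. *)
Lemma lmark_nsubseq beta u v b : lmark beta u v -> b \notin lstab (ev v) ->
  ~~ subseq (b :: beta) u /\ ~~ subseq (b :: beta) v.
Proof.
move=> uv; elim: uv b => {beta u v}
  [u v u1 v1 b|beta b w u w' v ww ww' bv _ IH c].
  rewrite -[ev v]mulg1 lstab_prod // !sub1seq => b1.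
  by split; apply: contra b1; [move: u1 | move: v1] => /allP; apply.
rewrite big_cat big_cons lstab_prod // => cv.
have skip t : all (mem (lstab (b * ev v))) t -> c \notin t.
  by move=> tv; apply: contra cv => /(allP tv).
have step t : ~~ subseq (b :: beta) t -> ~~ subseq (c :: b :: beta) (b :: t).
  move=> bt; rewrite [subseq _ _]/=; case: eqP => // _.
  by apply: contra bt; apply: cons_subseq.
by rewrite !subseq_skip ?skip //; have [/step ? /step] := IH _ bv.
Qed.

Lemma lmark_inv beta u v : lmark beta u v ->
  [/\ beta = [::], all (mem (lstab (1 : M))) u & all (mem (lstab (1 : M))) v] \/
  exists b beta' w u' w' v', [/\ beta = b :: beta', u = w ++ b :: u',
    v = w' ++ b :: v' & [/\ all (mem (lstab (b * ev v'))) w,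
    all (mem (lstab (b * ev v'))) w', b \notin lstab (ev v') &
    lmark beta' u' v']].
Proof.
case=> [|{}beta b w {}u w' {}v ww ww' bv uv]; [by left | right].
by exists b, beta, w, u, w', v.
Qed.

Lemma rstab_step p w a : all (mem (rstab p)) w -> a \in rstab p ->
  rstab (p * ev w * a) = rstab p.
Proof. by move=> /rstab_prod pw pa; rewrite rstab_mul ?pw. Qed.

Lemma prod_step p w w' a u v :
  all (mem (rstab p)) w -> all (mem (rstab p)) w' ->
  all (mem (lstab (a * ev v))) w -> all (mem (lstab (a * ev v))) w' ->
  p * ev w * a * ev u = p * ev w * a * ev v ->
  p * ev (w ++ a :: u) = p * ev (w' ++ a :: v).
Proof.
move=> pw pw' vw vw' uv.
by rewrite !big_cat !big_cons !mulgA uv -!(mulgA _ a) !delete_word.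
Qed.

(** Induction on the total length, moving the leftmost block and its mark into [p]. [k] counts the
    L-marks already passed; [beta0] stays fixed because the order conditions in [rmark] refer to
    it. *)
Lemma marks_prod beta0 k p u v :
  rmark beta0 p u v -> lmark (drop k beta0) u v -> p * ev u = p * ev v.
Proof.
have [n] := ubnP (size u + size v).
elim: n p u v k => // n IHn p u v k lt_n Ruv.
case: Ruv lt_n => {p u v} [p u v pu pv|p w a u w' v pw pw' pa uvE Ruv] lt_n.
  case/lmark_inv=> [[_ u1 v1]|].
    by rewrite -[LHS]mulg1 -[RHS]mulg1 !delete_word.
  move=> [b [beta [w [u' [w' [v' [Dbeta Du Dv [bw bw' bv Luv]]]]]]]].
  move: pu pv lt_n; rewrite Du Dv !all_cat /=.
  move=> /and3P[pw pb pu] /and3P[pw' _ pv] lt_n.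
  have lt_uv := size_cat_lt lt_n.
  apply: prod_step => //; apply: (IHn _ _ _ k.+1) => //.
    by apply: RmarkNil; rewrite rstab_step.
  by rewrite -[k.+1]add1n -drop_drop Dbeta /= drop0.
have lt_uv := size_cat_lt lt_n.
(* If no L-mark is left, every remaining letter stabilises 1 on the left, and the cut is at [a]. *)
case/lmark_inv=> [[Dbeta u1 v1]|].
  move: u1 v1; rewrite !all_cat /=.
  move=> /and3P[w1 a1 u1] /and3P[w1' _ v1].
  have E1 : lstab (a * ev v) = lstab (1 : M).
    by have := @lstab_prod 1 (a :: v); rewrite big_cons mulg1 /= a1; apply.
  apply: prod_step; rewrite ?E1 //; apply: (IHn _ _ _ k) => //.
  by rewrite Dbeta; apply: LmarkNil.
move=> [b [beta [t [u' [t' [v' [Dbeta Du Dv [bt bt' bv Luv]]]]]]]].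
have Dbeta' : drop k.+1 beta0 = beta.
  by rewrite -[k.+1]add1n -drop_drop Dbeta /= drop0.
(* [b :: beta] embeds after [a] exactly when [b] lies to the right of [a]; when [b = a] as letters,
   embedding [beta] after [a] separates equal positions from [b] on the left. *)
have := uvE k; have := uvE k.+1; rewrite Dbeta Dbeta' => uvE1 uvE0.
have [subu subv] := lmark_subseq Luv.
have [nsubu nsubv] := lmark_nsubseq Luv bv.
have sub_lt x y : subseq beta y -> subseq (b :: beta) (x ++ b :: y).
  by move=> by_; apply: subseq_catl; rewrite /= eqxx.
have nsub_gt x y : ~~ subseq (b :: beta) (x ++ a :: y) ->
    subseq (b :: beta) y = false /\ (b = a -> subseq beta y = false).
  move=> nxy; split=> [|eq_ba]; apply/negbTE; apply: contra nxy => yb.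
    by apply: subseq_catl; apply: subseq_trans yb (subseq_cons _ _).
  by apply: subseq_catl; rewrite /= eq_ba eqxx.
have lt_uv' : (size u' + size v' < n)%N.
  by rewrite Du Dv in lt_n; apply: size_cat_lt lt_n.
(* Of the nine cases, the three with the same order in both words allow an exchange at the leftmost
   mark; the other six contradict these tests. *)
move: pw pw' uvE0 uvE1 Ruv.
case: (cat_splitP Du) => [t1 Dt Du1|Dt Dba Du1|w1 Dw Du1];
  case: (cat_splitP Dv) => [t1' Dt' Dv1|Dt' Dba' Dv1|w1' Dw' Dv1].
- move: bt bt'; rewrite Dt Dt' Du1 Dv1 !all_cat /=.
  move=> /and3P[wb ab t1b] /and3P[w'b _ t1'b] pw pw' _ _ Ruv.
  have E1 : lstab (a * ev (t1' ++ b :: v')) = lstab (b * ev v').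
    have := @lstab_prod (b * ev v') (a :: t1').
    by rewrite big_cat !big_cons -mulgA /= ab; apply.
  apply: prod_step; rewrite ?E1 //; apply: (IHn _ _ _ k) Ruv _ => //.
    by rewrite -Du1 -Dv1.
  by rewrite Dbeta; apply: LmarkCons.
- by move=> _ _; rewrite Du1 sub_lt // -Dv1 (negPf nsubv).
- move: nsubv; rewrite Dv1 => /nsub_gt[E _].
  by move=> _ _; rewrite Du1 sub_lt // E.
- by move=> _ _; rewrite Dv1 sub_lt // -Du1 (negPf nsubu).
- rewrite -Du1 -Dv1 -Dt -Dt' -Dba => pw pw' _ _ Ruv.
  apply: prod_step => //; apply: (IHn _ _ _ k.+1) Ruv _ => //.
  by rewrite Dbeta'.
- move: nsubv; rewrite Dv1 => /nsub_gt[_ E].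
  by move=> _ _ _; rewrite -Du1 subu E.
- move: nsubu; rewrite Du1 => /nsub_gt[E _].
  by move=> _ _; rewrite Dv1 sub_lt // E.
- move: nsubu; rewrite Du1 => /nsub_gt[_ E].
  by move=> _ _ _; rewrite -Dv1 subv E.
rewrite Dw Dw' !all_cat /=.
move=> /and3P[pt pb pw1] /and3P[pt' _ pw1'] _ _ Ruv.
have Ep : rstab (p * ev t * b) = rstab p by rewrite rstab_step.
rewrite -!catA !cat_cons -Du1 -Dv1.
apply: prod_step => //; apply: (IHn _ _ _ k.+1) => //.
  rewrite Du1 Dv1; apply: RmarkCons; rewrite ?Ep //.
  by move: Ruv; rewrite big_cat big_cons !mulgA.
by rewrite Dbeta'.
Qed.
End Marks.

(** * Recognising marked factorisations *)

(* For pi = (B_1, b_1) ... (B_k, b_k), with each b_i outside B_i, this is the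
   language B_1^* b_1 ... B_k^* b_k e^*. *)
Fixpoint accepts (A : finType) (pi : seq ({set A} * A)) (e : {set A})
    (w : seq A) : bool :=
  match w, pi with
  | [::], _ => nilp pi
  | a :: w', [::] => (a \in e) && accepts [::] e w'
  | a :: w', (B, b) :: pi' =>
      if a \in B then accepts pi e w' else (a == b) && accepts pi' e w'
  end.

Definition agree (A : finType) (K : nat) (u v : seq A) : Prop :=
  forall pi e, (size pi <= K)%N -> accepts pi e u = accepts pi e v.

Section Patterns.
Variable A : finType.
Implicit Types (B e : {set A}) (pi : seq ({set A} * A)) (u v w : seq A).

Lemma accepts_nil e w : accepts [::] e w = all (mem e) w.
Proof. by elim: w => //= a w ->. Qed.

Lemma accepts_cons B a pi e w u : all (mem B) w -> a \notin B ->
  accepts ((B, a) :: pi) e (w ++ a :: u) = accepts pi e u.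
Proof.
move=> wB aB; elim: w wB => [|b w IHw] /=; first by rewrite (negPf aB) eqxx.
by move=> /andP[-> /IHw].
Qed.

Lemma accepts_consP B a pi e v : accepts ((B, a) :: pi) e v ->
  exists w v', v = w ++ a :: v' /\ all (mem B) w.
Proof.
elim: v => //= b v IHv.
case: ifP => [bB /IHv[w [v' [-> wB]]]|_ /andP[/eqP -> _]].
  by exists (b :: w), v'; rewrite /= bB.
by exists [::], v.
Qed.

(** Skipping the letters other than [b] before reading [b] is the leftmost embedding of [s], so
    patterns also test subwords. *)
Lemma accepts_subseq s w :
  accepts [seq (~: [set b], b) | b <- s] [set: A] w = subseq s w.
Proof.
elim: w s => [|a w IHw] [|b s] //=; first by rewrite in_setT (IHw [::]) sub0seq.
by rewrite -[(_, _) :: _]/(map _ (b :: s)) !IHw !inE [b == a]eq_sym; case: eqP.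
Qed.

Lemma all_or_split B w :
  all (mem B) w \/
  exists w1 a w2, [/\ w = w1 ++ a :: w2, all (mem B) w1 & a \notin B].
Proof.
elim: w => [|a w IHw]; first by left.
have [aB|aB] := boolP (a \in B); last by right; exists [::], a, w.
case: IHw => [wB|[w1 [b [w2 [-> w1B bB]]]]]; [left | right].
  by rewrite /= aB.
by exists (a :: w1), b, w2; rewrite /= aB.
Qed.

Lemma agree_sym K u v : agree K u v -> agree K v u.
Proof. by move=> uv pi e lepi; rewrite uv. Qed.

Lemma agree_all K B u v : agree K u v -> all (mem B) u -> all (mem B) v.
Proof. by move=> uv; rewrite -!accepts_nil uv. Qed.

(** Putting [(B, a)] in front of a pattern tests what follows the first letter outside [B], at the
    cost of one unit of [K]. *)
Lemma agree_split K B w a u v : all (mem B) w -> a \notin B ->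
  agree K.+1 (w ++ a :: u) v ->
  exists w' v', [/\ v = w' ++ a :: v', all (mem B) w' & agree K u v'].
Proof.
move=> wB aB uv.
have : accepts [:: (B, a)] setT v.
  by rewrite -uv // accepts_cons // (accepts_subseq [::]) sub0seq.
move=> /accepts_consP[w' [v' [Dv w'B]]]; exists w', v'; split=> // pi e lepi.
by rewrite -(accepts_cons pi e u wB aB) uv // Dv accepts_cons.
Qed.

Lemma agree_subseq K s u v :
  (size s <= K)%N -> agree K u v -> subseq s u = subseq s v.
Proof. by move=> les uv; rewrite -!accepts_subseq uv // size_map. Qed.

End Patterns.

(** * From agreement on patterns to marked factorisations *)

Section AgreeMarks.
Variable M : finMonoidType.
Hypothesis RLM : rl_identity M.
Implicit Types (p s : M) (u v w beta : seq M).

(** Every R-descent shrinks the right ideal of [p] and costs one unit of [K]; the other [size beta]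
    units keep the suffixes of [beta] testable. *)
Lemma agree_rmark K beta p u v : (#|rideal p| + size beta <= K)%N ->
  agree K u v -> rmark beta p u v.
Proof.
have [n] := ubnP (size u).
elim: n K p u v => // n IHn K p u v lt_n leK uv.
have [pu|[w [a [u' [Du pw pa]]]]] := all_or_split (rstab p) u.
  by apply: RmarkNil => //; apply: agree_all uv pu.
have lt_p : (#|rideal (p * ev w * a)%g| < #|rideal p|)%N.
  have Ep := rstab_prod RLM pw; rewrite -Ep in pa.
  apply: leq_trans (card_rideal_lt pa) _; apply/subset_leq_card/subsetP.
  by move=> _ /imsetP[m _ ->]; rewrite -mulgA; apply: imset_f.
have lt_u : (size u' < n)%N.
  move: lt_n; rewrite Du size_cat addnS !ltnS.
  by apply: leq_trans; rewrite ltnS leq_addl.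
case: K leK uv => [|K] leK uv; first by case: #|rideal p| lt_p leK.
have leK' : (#|rideal (p * ev w * a)%g| + size beta <= K)%N by lia.
move: uv; rewrite Du => /(agree_split pw pa)[w' [v' [-> pw' uv']]].
apply: RmarkCons => // [k|]; last exact: IHn uv'.
apply: agree_subseq uv'; rewrite size_drop (leq_trans (leq_subr _ _)) //.
exact: leq_trans (leq_addl _ _) leK'.
Qed.

(** [x] and [y] are the unread prefixes in reverse, [u] and [v] the parts already read from the
    right. The current block is still open, whence the quantification over [w] and [w']; each new
    letter of [beta] shrinks the left ideal. *)
Lemma agree_lmark K beta x y u v : (#|lideal (ev v)| <= K)%N ->
  agree K x y ->
  (forall w w', all (mem (lstab (ev v))) w -> all (mem (lstab (ev v))) w' ->
     lmark beta (w ++ u) (w' ++ v)) ->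
  exists2 beta', lmark beta' (catrev x u) (catrev y v) &
    (size beta' <= size beta + #|lideal (ev v)|)%N.
Proof.
have [n] := ubnP (size y).
elim: n K beta x y u v => // n IHn K beta x y u v lt_n leK xy uv.
have [sy|[w' [a [y' [Dy sw' sa]]]]] := all_or_split (lstab (ev v)) y.
  have sx : all (mem (lstab (ev v))) x.
    by apply: agree_all sy; apply: agree_sym xy.
  exists beta; last exact: leq_addr.
  by rewrite !catrevE; apply: uv; rewrite all_rev.
have Es : lstab (ev (rev w' ++ v)) = lstab (ev v).
  by rewrite big_cat lstab_prod ?all_rev.
have lt_s : (#|lideal (a * ev (rev w' ++ v))%g| < #|lideal (ev v)|)%N.
  have sa' := sa; rewrite -Es in sa'.
  apply: leq_trans (card_lideal_lt sa') _; apply/subset_leq_card/subsetP.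
  by move=> _ /imsetP[m _ ->]; rewrite big_cat mulgA; apply: imset_f.
have lt_y : (size y' < n)%N.
  move: lt_n; rewrite Dy size_cat addnS !ltnS.
  by apply: leq_trans; rewrite ltnS leq_addl.
case: K leK xy => [|K] leK xy; first by case: #|lideal (ev v)| lt_s leK.
move: xy => /agree_sym; rewrite Dy => /(agree_split sw' sa)[w [x' [Dx sw yx]]].
have [|||beta' Lb leb] :=
    IHn K (a :: beta) x' y' (a :: catrev w u) (a :: catrev w' v) lt_y.
- by rewrite big_cons catrevE -ltnS; apply: leq_trans lt_s leK.
- exact: agree_sym.
- rewrite !catrevE => t t'; rewrite big_cons => st st'.
  by apply: LmarkCons; rewrite ?Es //; apply: uv; rewrite all_rev.
exists beta'.
  by rewrite Dx !catrevE !rev_cat !rev_cons -!cats1 -!catA -!catrevE.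
by apply: leq_trans leb _; rewrite big_cons catrevE /= addSnnS leq_add2l.
Qed.

Lemma agree_prod u v : agree (2 * #|M|) u v -> agree #|M| (rev u) (rev v) ->
  ev u = ev v.
Proof.
move=> uvR uvL.
have [|beta] := @agree_lmark _ [::] _ _ [::] [::] (max_card _) uvL.
  by move=> w w'; rewrite !cats0 big_nil; apply: LmarkNil.
rewrite !catrevE !revK !cats0 add0n => Luv leb.
rewrite -[ev u]mul1g -[ev v]mul1g.
apply: (@marks_prod _ RLM beta 0); last by rewrite drop0.
(* One [#|M|] bounds the right ideal of 1, the other the length of [beta]. *)
apply: agree_rmark uvR; rewrite mul2n -addnn leq_add ?max_card //.
by apply: leq_trans leb _; apply: max_card.
Qed.

End AgreeMarks.

(** * Monoids of rank-decreasing maps *)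

(** Transitions of an automaton without cycles other than loops. *)
Definition rank_decreasing (Q : finType) (rk : Q -> nat) (f : {ffun Q -> Q}) :=
  [forall q, (f q == q) || (rk (f q) < rk q)%N].

Record rank_map (Q : finType) (rk : Q -> nat) : Type :=
  RankMap { rank_fun :> {ffun Q -> Q}; _ : rank_decreasing rk rank_fun }.

Section RankMap.
Variables (Q : finType) (rk : Q -> nat).

HB.instance Definition _ := [isSub for @rank_fun Q rk].
HB.instance Definition _ := [Finite of rank_map rk by <:].

Lemma rank_mapP (f : rank_map rk) (q : Q) : f q = q \/ (rk (f q) < rk q)%N.
Proof.
by have /forallP/(_ q)/orP[/eqP|] := valP f; [left | right].
Qed.

Lemma rank_map1_subproof : rank_decreasing rk [ffun q => q].
Proof. by apply/forallP => q; rewrite ffunE eqxx. Qed.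

Definition rank_map1 := RankMap rank_map1_subproof.

Lemma rank_map_mul_subproof (f g : rank_map rk) :
  rank_decreasing rk [ffun q => g (f q)].
Proof.
apply/forallP => q; rewrite ffunE.
have [->|lt_f] := rank_mapP f q.
  by have [->|->] := rank_mapP g q; rewrite ?eqxx ?orbT.
have [->|lt_g] := rank_mapP g (f q); first by rewrite lt_f orbT.
by rewrite (ltn_trans lt_g lt_f) orbT.
Qed.

Definition rank_map_mul (f g : rank_map rk) :=
  RankMap (rank_map_mul_subproof f g).

Lemma rank_map_mulA : associative rank_map_mul.
Proof. by move=> f g h; apply/val_inj/ffunP => q; rewrite !ffunE. Qed.

Lemma rank_map_mul1 : left_id rank_map1 rank_map_mul.
Proof. by move=> f; apply/val_inj/ffunP => q; rewrite !ffunE. Qed.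

Lemma rank_map_1mul : right_id rank_map1 rank_map_mul.
Proof. by move=> f; apply/val_inj/ffunP => q; rewrite !ffunE. Qed.

HB.instance Definition _ :=
  isMonoid.Build (rank_map rk) rank_map_mulA rank_map_mul1 rank_map_1mul.

Lemma rank_mulE (f g : rank_map rk) (q : Q) : (f * g) q = g (f q).
Proof. by rewrite [LHS]ffunE. Qed.

(** Where [f] and [g] differed, each value would have smaller rank than the other. *)
Lemma Rtrivial_rank_map : Rtrivial (rank_map rk).
Proof.
move=> f g; split=> [/greenRP[[a Da] [b Db]]|->] //.
apply/val_inj/ffunP => q /=.
have [ga|ga] := rank_mapP a (f q); first by rewrite -Da rank_mulE ga.
have [fb|fb] := rank_mapP b (g q); first by rewrite -Db rank_mulE fb.
by move: ga fb; rewrite -!rank_mulE Da Db => /ltnW; rewrite leqNgt => /negPf ->.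
Qed.

End RankMap.

(** * An R-trivial monoid recognising the patterns of bounded length *)

Section PatternMonoid.
Variables (A : finType) (K : nat).

(** A state is the pattern still to be read, [None] the rejecting sink; bounded sequences keep the
    set finite. *)
Definition pattern_state : finType :=
  option (K.-bseq ({set A} * A) * {set A}).

Definition pattern_rank (q : pattern_state) : nat :=
  if q is Some (pi, _) then (size pi).+1 else 0.

Definition pattern_step (a : A) (q : pattern_state) : pattern_state :=
  if q is Some (pi, e) then
    match bseqval pi with
    | [::] => if a \in e then q else None
    | (B, b) :: pi' =>
        if a \in B then q
        else if a == b then Some (insub_bseq K pi', e) else None
    end
  else None.

Definition pattern_final (q : pattern_state) : bool :=
  if q is Some (pi, _) then nilp pi else false.

Lemma insub_bseqE pi : (size pi <= K)%N ->
  insub_bseq K pi = pi :> seq ({set A} * A).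
Proof. by move=> lepi; rewrite /insub_bseq -[LHS]/(\val _) insubdK. Qed.

Lemma pattern_step_subproof (a : A) :
  rank_decreasing pattern_rank [ffun q => pattern_step a q].
Proof.
apply/forallP => -[[[pi lepi] e]|]; rewrite ffunE // /pattern_step /=.
case: pi lepi => [|[B b] pi] lepi; case: ifP => _; rewrite ?eqxx //=.
case: ifP => // _ /=; rewrite insub_bseqE ?ltnSn ?orbT //.
exact: ltnW.
Qed.

Definition pattern_letter (a : A) : rank_map pattern_rank :=
  RankMap (pattern_step_subproof a).

Lemma pattern_prodE w q :
  (\prod_(a <- w) pattern_letter a) q = foldl (fun q a => pattern_step a q) q w.
Proof.
elim: w q => [|a w IHw] q; first by rewrite big_nil [LHS]ffunE.
by rewrite big_cons rank_mulE IHw [pattern_letter a q]ffunE.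
Qed.

Lemma pattern_finalE w (pi : K.-bseq ({set A} * A)) e :
  pattern_final (foldl (fun q a => pattern_step a q) (Some (pi, e)) w) =
  accepts pi e w.
Proof.
have None_final u :
  pattern_final (foldl (fun q a => pattern_step a q) None u) = false by elim: u.
elim: w pi => //= a w IHw pi; case: pi => -[|[B b] pi] lepi /=.
  by rewrite -(IHw (Bseq lepi)); case: ifP.
case: ifP => _; first exact: IHw.
by case: ifP => //= _; rewrite IHw insub_bseqE // ltnW.
Qed.

Lemma pattern_agree u v :
  \prod_(a <- u) pattern_letter a = \prod_(a <- v) pattern_letter a ->
  agree K u v.
Proof.
move=> uv pi e lepi; rewrite -(insub_bseqE lepi) -!pattern_finalE.
by rewrite -!pattern_prodE uv.
Qed.

End PatternMonoid.

(** * Division by a product *)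

Section Generated.
Variables (P : finMonoidType) (A : finType) (g : A -> P).

(** Reachability from 1 in the right Cayley graph makes membership in the generated submonoid
    boolean. *)
Definition generated (x : P) : bool :=
  connect [rel y z | [exists a, z == y * g a]] 1 x.

Lemma generatedP (x : P) :
  reflect (exists w, \prod_(a <- w) g a = x) (generated x).
Proof.
apply: (iffP connectP) => [[s]|[w <-]].
  elim/last_ind: s x => [|s y IHs] x /=.
    by move=> _ ->; exists [::]; rewrite big_nil.
  rewrite rcons_path last_rcons => /andP[/IHs/(_ erefl)[w Dw]].
  move=> /existsP[a /eqP ->] ->; exists (rcons w a).
  by rewrite -cats1 big_cat big_seq1 Dw.
apply/connectP; elim/last_ind: w => [|w a IHw]; first by rewrite big_nil.
apply: connect_trans IHw (connect1 _); apply/existsP; exists a.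
by rewrite -cats1 big_cat big_seq1.
Qed.

Record gen_monoid : Type :=
  GenMonoid { gen_val :> P; gen_valP : generated gen_val }.

HB.instance Definition _ := [isSub for gen_val].
HB.instance Definition _ := [Finite of gen_monoid by <:].

Lemma generated_closed : monoid_closed generated.
Proof.
split=> [|x y]; first by apply/generatedP; exists [::]; rewrite big_nil.
move=> /generatedP[u Du] /generatedP[v Dv]; apply/generatedP.
by exists (u ++ v); rewrite big_cat Du Dv.
Qed.

HB.instance Definition _ :=
  SubChoice_isSubMonoid.Build P generated gen_monoid generated_closed.

End Generated.

(** The pairs [(g1 a, g2 a)] generate a submonoid of [N1 * N2] on which, by separation, evaluating
    any representing word in [M] is a well-defined morphism; it is onto since [g] generates [M]. *)
Lemma join_of_separation (V1 V2 : monoid_class) (M N1 N2 : finMonoidType)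
    (A : finType) (g1 : A -> N1) (g2 : A -> N2) (g : A -> M) :
    V1 N1 -> V2 N2 -> (forall x, exists w, \prod_(a <- w) g a = x) ->
    (forall u v, \prod_(a <- u) g1 a = \prod_(a <- v) g1 a ->
       \prod_(a <- u) g2 a = \prod_(a <- v) g2 a ->
       \prod_(a <- u) g a = \prod_(a <- v) g a) ->
  join V1 V2 M.
Proof.
move=> VN1 VN2 genM sep W varW subV1 subV2.
have [_ Wprod Wsub Wquo] := varW.
pose h (a : A) : (N1 * N2)%type := (g1 a, g2 a).
have hE w : \prod_(a <- w) h a = (\prod_(a <- w) g1 a, \prod_(a <- w) g2 a).
  by elim: w => [|a w IHw]; rewrite ?big_nil // !big_cons IHw.
have word (x : gen_monoid h) : exists w, \prod_(a <- w) h a == val x.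
  by have /generatedP[w Dw] := gen_valP x; exists w; apply/eqP.
pose f (x : gen_monoid h) : M := \prod_(a <- xchoose (word x)) g a.
have chosen x : \prod_(a <- xchoose (word x)) h a = val x.
  exact: (eqP (xchooseP (word x))).
have fE x w : \prod_(a <- w) h a = val x -> f x = \prod_(a <- w) g a.
  move=> Dw; have := etrans (chosen x) (esym Dw); rewrite !hE.
  by case=> /sep; apply.
have fM : monoid_morphism f.
  split=> [|x y]; first by rewrite (fE _ [::]) big_nil.
  rewrite (fE (x * y) (xchoose (word x) ++ xchoose (word y))) ?big_cat //.
  by rewrite !chosen.
pose fU : UMagmaMorphism.type (gen_monoid h) M :=
  HB.pack f (isUMagmaMorphism.Build _ _ f fM).
apply: (Wquo _ _ fU) => [x|].
  have [w <-] := genM x.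
  have wP : generated h (\prod_(a <- w) h a) by apply/generatedP; exists w.
  by exists (GenMonoid wP); apply: fE.
pose valU : UMagmaMorphism.type (gen_monoid h) (N1 * N2)%type := val.
apply: (Wsub _ _ valU); first exact: val_inj.
by apply: Wprod; [apply: subV1 | apply: subV2].
Qed.

(** The alphabet is [M] itself. The pattern monoid reads words from the left; the opposite of one
    reads them from the right and is L-trivial. *)
Lemma rl_identity_join (M : finMonoidType) :
  rl_identity M -> join Rtrivial Ltrivial M.
Proof.
move=> RLM.
pose g1 := @pattern_letter M (2 * #|M|); pose g2 := @pattern_letter M #|M|.
pose N2 : finMonoidType := opp_monoid (rank_map (@pattern_rank M #|M|)).
apply: (@join_of_separation _ _ M _ N2 M g1 g2 id).
- exact: Rtrivial_rank_map.
- exact/Rtrivial_opp/Rtrivial_rank_map.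
- by move=> x; exists [:: x]; rewrite big_seq1.
move=> u v uv1 uv2; apply: agree_prod => //; apply: pattern_agree => //.
by rewrite -!opp_prod.
Qed.

(** * The identity defines a variety *)

Lemma omega_morph (M N : finMonoidType) (f : UMagmaMorphism.type M N) (x : M) :
  f (omega x) = omega (f x).
Proof.
rewrite /omega gmulfXn; apply/esym/omega_uniq; first exact: omega_exp_gt0.
by rewrite /idem -gmulfXn -gmulfM omegaM.
Qed.

Lemma omega_pair (M N : finMonoidType) (x : M) (y : N) :
  omega ((x, y) : (M * N)%type) = (omega x, omega y).
Proof.
have pairX n : ((x, y) : (M * N)%type) ^+ n = (x ^+ n, y ^+ n).
  by elim: n => // n IHn; rewrite !expgS IHn.
have := omegaM ((x, y) : (M * N)%type); rewrite /omega pairX => -[Dx Dy].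
by congr pair; apply/esym/omega_uniq; rewrite ?omega_exp_gt0 //; apply/eqP.
Qed.

Lemma variety_rl_identity : variety rl_identity.
Proof.
split=> [M M1 x y z | M N RM RN [x1 x2] [y1 y2] [z1 z2] | M N f injf RM x y z
  | M N f surjf RM x y z].
- by have /card_le1_eqP : (#|M| <= 1)%N; [rewrite M1 | apply].
- have pairM (a b : M) (c d : N) :
    ((a, c) : (M * N)%type) * (b, d) = (a * b, c * d) by [].
  by rewrite !(pairM, omega_pair) RM RN.
- by apply: injf; rewrite !gmulfM !omega_morph !gmulfM RM.
have [[x' <-] [y' <-] [z' <-]] := And3 (surjf x) (surjf y) (surjf z).
by rewrite -!gmulfM -!omega_morph -!gmulfM RM.
Qed.

Lemma Rtrivial_rl_identity : subclass Rtrivial rl_identity.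
Proof.
move=> M RM x y z; congr (_ * _); apply/esym/RM/greenRP.
split; first by exists x.
exists (y * (x * y) ^+ (omega_exp M).-1).
by rewrite -mulgA (mulgA x) -expgS prednK ?omega_exp_gt0 // omegaM.
Qed.

Lemma Ltrivial_rl_identity : subclass Ltrivial rl_identity.
Proof. by move=> M /Ltrivial_opp/Rtrivial_rl_identity/rl_identity_opp. Qed.

Theorem theorem6 :
  (let x := OVar 0 in let y := OVar 1 in let z := OVar 2 in
   forall M : finMonoidType,
     join Rtrivial Ltrivial M <->
     ⟦ (x * y)^ω * x * (z * x)^ω = (x * y)^ω * (z * x)^ω ⟧ M) /\
  (forall M : finMonoidType,
     join Rtrivial Ltrivial M <->
     forall x y z : M,
       omega (x * y) * x * omega (z * x) = omega (x * y) * omega (z * x)).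
Proof.
have joinP (M : finMonoidType) : join Rtrivial Ltrivial M <-> rl_identity M.
  split=> [joinM|]; last exact: rl_identity_join.
  (* The class of the identity is one of the varieties intersected in [join]. *)
  apply: joinM; first exact: variety_rl_identity.
    exact: Rtrivial_rl_identity.
  exact: Ltrivial_rl_identity.
split=> [x y z M|M]; last exact: joinP.
split=> [/joinP RLM a|RLM]; first exact: RLM.
(* Variables beyond the third are sent to 1. *)
by apply/joinP => a b c; apply: (RLM (nth 1 [:: a; b; c])).
Qed.
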